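(* Let $n\ge1$, and let $$A=\begin{pmatrix}0&1&1\\0&0&1\\1&0&1\end{pmatrix}$$ over $\mathbb F_2$. Consider the $2^n\times2^n\times2^n$ block of copies of $A$ with cyclic (triply periodic) boundary conditions, all permitted spin configurations being equally probable. Take four different spins lying on edges parallel to the first coordinate axis that all intersect one fixed plane perpendicular to that axis. If the four spins are in the vertices of a $2^{n-1}\times2^{n-1}$ square, then the probability for them all to take the value $0\in\mathbb F_2$ is $\frac18$. Otherwise, this probability is $\frac1{16}$, so the four spins are independent.
   Context: Vertices are $v=(v_1,v_2,v_3)\in(\mathbb Z/2^n)^3$ (cyclic boundary conditions: each output edge is identified with the input edge on the same line parallel to a coordinate axis). For each vertex $v$ and each direction $i\in\{1,2,3\}$ there is a spin $s_i(v)\in\mathbb F_2$ on the edge parallel to the $i$-th axis entering $v$. With $\epsilon_i$ the $i$-th unit vector, a spin configuration is permitted if at every vertex $$\begin{pmatrix}s_1(v+\epsilon_1)& s_2(v+\epsilon_2)& s_3(v+\epsilon_3)\end{pmatrix}=\begin{pmatrix}s_1(v)& s_2(v)& s_3(v)\end{pmatrix}A .$$ The probability measure is uniform on the (finite, nonempty) set of permitted configurations. The spins under consideration are the $s_1(v)$ with $v_1=c$ for a fixed $c$; each is located at the point $(v_2,v_3)$ of $(\mathbb Z/2^n)^2$. Four points are in the vertices of a $2^{n-1}\times2^{n-1}$ square if they are $(y,z),(y+2^{n-1},z),(y,z+2^{n-1}),(y+2^{n-1},z+2^{n-1})$ for some $y,z\in\mathbb Z/2^n$. *)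

(* Defs.v *)
From HB Require Import structures.
From mathcomp Require Import all_boot all_order all_algebra.

Set Implicit Arguments.
Unset Strict Implicit.
Unset Printing Implicit Defensive.
Import Order.TTheory GRing.Theory Num.Theory.
Local Open Scope ring_scope.

(* 'Z_m is Z/m only for m >= 2, so everything below is meant for n >= 1. *)
Definition vertex (n : nat) := 'rV['Z_(2 ^ n)]_3.

(* [s i v] is the spin on the edge parallel to axis i that enters v.
   Coordinates and axes are numbered from 0. *)
Definition config (n : nat) := {ffun 'I_3 -> {ffun vertex n -> 'F_2}}.

Definition permitted (n : nat) (A : 'M['F_2]_3) : {set config n} :=
  [set s : config n | [forall v : vertex n,
     \row_i s i (v + delta_mx 0 i) == (\row_i s i v) *m A]].

Lemma permitted_neq0 (n : nat) (A : 'M['F_2]_3) : permitted n A != set0.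
Proof.
apply/set0Pn; exists [ffun _ => [ffun _ => 0]].
rewrite inE; apply/forallP => v; apply/eqP/rowP => j.
by rewrite !mxE !ffunE big1 // => i _; rewrite !mxE !ffunE mul0r.
Qed.

Definition matA : 'M['F_2]_3 :=
  \matrix_(i < 3, j < 3)
    (nth [::] [:: [:: 0; 1; 1]; [:: 0; 0; 1]; [:: 1; 0; 1]] i)`_j.

(* Probability of E under the uniform distribution on Om. *)
Definition prob (T : finType) (Om E : {set T}) : rat :=
  #|Om :&: E|%:R / #|Om|%:R.

(* Mutual independence, under the uniform distribution on Om, of the random
   variables X i for i in P. *)
Definition independent (T I U : finType) (Om : {set T}) (X : I -> T -> U)
    (P : {set I}) : Prop :=
  forall (J : {set I}) (B : I -> {set U}), J \subset P ->
    prob Om [set t | [forall i in J, X i t \in B i]]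
    = \prod_(i in J) prob Om [set t | X i t \in B i].

Definition point (n : nat) := ('Z_(2 ^ n) * 'Z_(2 ^ n))%type.

Definition plane_spin (n : nat) (c : 'Z_(2 ^ n)) (p : point n)
    (s : config n) : 'F_2 :=
  s 0 (\row_i [:: c; p.1; p.2]`_i).

Definition square (n : nat) (y z : 'Z_(2 ^ n)) : {set point n} :=
  let h := (2 ^ n.-1)%:R in
  [set (y, z); (y + h, z); (y, z + h); (y + h, z + h)].

(* Main.v *)
Require Import Defs.
From mathcomp Require Import all_boot all_order all_algebra.
From mathcomp Require Import ring zify.
Import GRing.Theory Num.Theory.
Local Open Scope ring_scope.

(** Eliminating [s_2] and [s_3], a permitted configuration is a function [s] on
    the torus with [s = s_1] and, writing [T_i] for the shift along axis [i] and
    [N = 2^n], [T_2^-1 s = (1 + T_1 + T_1 T_3) s]. Raising this to the power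
    [N/2] over F_2 gives [(1 + T_2^(N/2)) s = T_1^(N/2) (1 + T_3^(N/2)) s], and
    applying [1 + T_3^(N/2)] shows that the four spins at a square sum to 0.

    Conversely [s (i, y, z) = C(-y, N-1-i) C(z, i) mod 2] and its translates are
    permitted. A set of at most four points on whose spins all of these sum to 0
    meets every row and column evenly (take [i = 0] and [i = N-1]), so it is a
    rectangle; taking [i = N/2] and [i = N/2 - 1] forces both sides to be [N/2].
    A family of additive F_2-valued maps none of whose nonempty subsums vanishes
    identically is independent and uniform, by expanding in the characters
    [(-1)^x]. *)

(** * Characters of F_2 and independence *)

Lemma F2_2 : 2 = 0 :> 'F_2. Proof. exact: val_inj. Qed.

Lemma F2_cases (x : 'F_2) : x = 0 \/ x = 1.
Proof. by case: x => [[|[|m]] lt_m] //; [left|right]; apply: val_inj. Qed.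

Definition sgF2 (x : 'F_2) : rat := (-1) ^+ x.

Lemma sgF2D (x y : 'F_2) : sgF2 (x + y) = sgF2 x * sgF2 y.
Proof. by case: (F2_cases x) => ->; case: (F2_cases y) => ->. Qed.

Lemma sgF2_sum (I : finType) (K : {set I}) (f : I -> 'F_2) :
  sgF2 (\sum_(i in K) f i) = \prod_(i in K) sgF2 (f i).
Proof. exact: (big_morph sgF2 sgF2D). Qed.

(** Fourier expansion over the two characters of F_2; after averaging only the constant coefficient
    [#|B| / 2] will survive. *)
Lemma mem_F2_fourier (B : {set 'F_2}) (x : 'F_2) :
  (x \in B)%:R = #|B|%:R / 2
    + ((0 \in B)%:R - (1 \in B)%:R) / 2 * sgF2 x :> rat.
Proof.
have -> : #|B| = addn (0 \in B) (1 \in B).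
  rewrite -sum1_card big_mkcond /= 2!big_ord_recl big_ord0 addn0.
  have -> : lift ord0 ord0 = 1 :> 'F_2 by apply: val_inj.
  by do 2!case: ifP.
case: (F2_cases x) => ->; rewrite /sgF2 natrD.
  by rewrite /= expr0; field.
by rewrite /= expr1; field.
Qed.

(** Reindexing by [phi] changes the sign of every term, so the sum is its own negative. *)
Lemma sum_sgF2_eq0 (T : finType) (Om : {set T}) (Y : T -> 'F_2) (phi : T -> T) :
    injective phi -> (forall t, (phi t \in Om) = (t \in Om)) ->
    (forall t, Y (phi t) = Y t + 1) ->
  \sum_(t in Om) sgF2 (Y t) = 0.
Proof.
move=> phi_inj phi_Om Yphi; set S := LHS.
have : S = - S.
  rewrite /S {1}(reindex_inj phi_inj) -sumrN.
  by apply: eq_big => // t _; rewrite Yphi sgF2D /sgF2 expr1 mulrN1.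
by move/eqP; rewrite -addr_eq0 -mulr2n mulrn_eq0 => /eqP.
Qed.

(* [phi] stands for translation by an element of the subgroup [Om] on which the
   subsum over [K] does not vanish. *)
Lemma prob_free (T I : finType) (Om : {set T}) (X : I -> T -> 'F_2)
    (J : {set I}) (B : I -> {set 'F_2}) :
    Om != set0 ->
    (forall K : {set I}, K \subset J -> K != set0 ->
       exists phi : T -> T, [/\ injective phi,
         forall t, (phi t \in Om) = (t \in Om)
       & forall t, \sum_(i in K) X i (phi t) = \sum_(i in K) X i t + 1]) ->
  prob Om [set t | [forall i in J, X i t \in B i]]
    = \prod_(i in J) (#|B i|%:R / 2).
Proof.
move=> Om_n0 freeJ; rewrite /prob.
pose b i : rat := ((0 \in B i)%:R - (1 \in B i)%:R) / 2.
(* The values 0 and 1 outside [J] turn the product over [J] into one over all of [I], which expands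
   over all subsets [K]; those not inside [J] contribute 0. *)
pose F i t := if i \in J then b i * sgF2 (X i t) else 0.
pose G i : rat := if i \in J then #|B i|%:R / 2 else 1.
have Om_card_n0 : #|Om|%:R != 0 :> rat by rewrite pnatr_eq0 -lt0n card_gt0.
apply: (canLR (mulfK Om_card_n0)).
have -> : #|Om :&: [set t | [forall i in J, X i t \in B i]]|%:R
    = \sum_(t in Om) \prod_i (F i t + G i).
  rewrite -sum1_card natr_sum big_mkcond [RHS]big_mkcond /=.
  apply: eq_bigr => t _; rewrite inE; case: (t \in Om) => //=; rewrite inE.
  rewrite (eq_bigr (fun i => if i \in J then (X i t \in B i)%:R else 1)).
    case: forallP => [inB | notB].
      by rewrite big1 // => i _; case: ifP => // iJ; rewrite (implyP (inB i) iJ).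
    have [i] : exists i, ~~ ((i \in J) ==> (X i t \in B i)).
      apply/existsP; rewrite -negb_forall; exact/forallP.
    by rewrite negb_imply => /andP[iJ /negPf niB]; rewrite (bigD1 i) //= iJ niB mul0r.
  move=> i _; rewrite /F /G; case: ifP => _; last by rewrite add0r.
  by rewrite mem_F2_fourier addrC.
rewrite (eq_bigr (fun t => \sum_(K : {set I})
                             \prod_i (if i \in K then F i t else G i))); last first.
  by move=> t _; exact: bigA_distr.
rewrite exchange_big /= (bigD1 set0) //= [X in _ + X]big1 => [|K K_n0].
  rewrite addr0 mulr_natr -sumr_const; apply: eq_bigr => t _.
  by rewrite [RHS]big_mkcond; apply: eq_bigr => i _; rewrite inE.
have [KJ | /subsetPn[i iK niJ]] := boolP (K \subset J); last first.
  by rewrite big1 // => t _; rewrite (bigD1 i) //= iK /F (negPf niJ) mul0r.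
have [phi [phi_inj phi_Om Xphi]] := freeJ K KJ K_n0.
have S0 := sum_sgF2_eq0 _ _ (fun t => \sum_(i in K) X i t) _ phi_inj phi_Om Xphi.
rewrite (eq_bigr (fun t => \prod_i (if i \in K then b i else G i)
                           * sgF2 (\sum_(i in K) X i t))).
  by rewrite -mulr_sumr S0 mulr0.
move=> t _; rewrite sgF2_sum [X in _ * X]big_mkcond -big_split /=.
apply: eq_bigr => i _; case: ifP => [iK|]; last by rewrite mulr1.
by rewrite /F (subsetP KJ).
Qed.

(** * Small sets meeting all rows and columns evenly *)

Lemma F2_sum_other {T : finType} {K : {set T}} {Q : pred T} {p : T} :
    \sum_(q in K) (Q q)%:R = 0 :> 'F_2 -> p \in K -> Q p ->
  exists2 q, q \in K & (q != p) && Q q.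
Proof.
move=> sumK pK Qp; apply/exists_inP; apply: contra_eqT sumK.
rewrite negb_exists_in => /forall_inP noK.
rewrite (bigD1 p) //= Qp big1 ?addr0 ?oner_neq0 // => q /andP[qK ne_qp].
by have := noK q qK; rewrite ne_qp /= => /negPf->.
Qed.

(** Evenness gives each point a partner in its row and in its column. Following partners from
    [(a, b)] yields four distinct points, which exhaust [K]; the row partner of [(a, b')] must then
    be the fourth, which closes the rectangle. *)
Lemma F2_rectangle_even {T U : finType} {K : {set T * U}} :
    K != set0 -> (#|K| <= 4)%N ->
    (forall a, \sum_(p in K) (p.1 == a)%:R = 0 :> 'F_2) ->
    (forall b, \sum_(p in K) (p.2 == b)%:R = 0 :> 'F_2) ->
  exists a a' b b', [/\ a' != a, b' != b,
    uniq [:: (a, b); (a', b); (a, b'); (a', b')]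
    & K =i [:: (a, b); (a', b); (a, b'); (a', b')]].
Proof.
case/set0Pn=> -[a b] abK leK4 colK rowK.
have [[a1 b'] ab'K] := F2_sum_other (colK a) abK (eqxx _).
rewrite xpair_eqE /= => /andP[+ /eqP eq_a]; subst a1; rewrite eqxx /= => ne_b.
have [[a' b1] a'bK] := F2_sum_other (rowK b) abK (eqxx _).
rewrite xpair_eqE /= => /andP[+ /eqP eq_b]; subst b1; rewrite eqxx andbT => ne_a.
have [[a1 b2] a'b2K] := F2_sum_other (colK a') a'bK (eqxx _).
rewrite xpair_eqE /= => /andP[+ /eqP eq_a]; subst a1; rewrite eqxx /= => ne_b2.
have [[a2 b1] a2b'K] := F2_sum_other (rowK b') ab'K (eqxx _).
rewrite xpair_eqE /= => /andP[+ /eqP eq_b]; subst b1; rewrite eqxx andbT => ne_a2.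
pose r := [:: (a, b); (a', b); (a, b'); (a', b2)].
have r_uniq : uniq r.
  rewrite /r /= !inE !xpair_eqE !eqxx /= !andbT [a == a']eq_sym (negPf ne_a) /=.
  by rewrite [b == b']eq_sym [b == b2]eq_sym (negPf ne_b) (negPf ne_b2).
have eqK : K = [set p in r].
  apply/esym/eqP; rewrite eqEcard cardsE (card_uniqP r_uniq) leK4 andbT.
  by apply/subsetP => p; rewrite !inE => /or4P[] /eqP->.
have eq_b2 : b2 = b'.
  move: a2b'K; rewrite eqK !inE !xpair_eqE (negPf ne_a2) (negPf ne_b) !andbF /=.
  by case/andP=> _ /eqP.
subst b2; exists a, a', b, b'; split=> // p; by rewrite eqK inE.
Qed.

(** * Binomial coefficients mod 2 as functions on Z/2^n *)

(* The coefficient of X^i in (1 + X)^(2^n) (1 + X)^j = (1 + X^(2^n)) (1 + X)^j. *)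
Lemma odd_bin_add2X (n j i : nat) :
  odd 'C(j + 2 ^ n, i) =
    odd 'C(j, i) (+) ((2 ^ n <= i)%N && odd 'C(j, i - 2 ^ n)).
Proof.
elim: n j i => [|n IHn] j i.
  by case: i => [|i]; rewrite addn1 ?bin0 // binS oddD subn1.
rewrite expnS mul2n -addnn addnA !IHn subnDA -addbA; congr (_ (+) _).
have [lt_i | le_i] := ltnP i (2 ^ n); first by rewrite [(_ <= i)%N]leqNgt ltn_addr // addbF.
(* The two applications of the induction hypothesis both produce C(j, i - 2^n), which cancels mod
   2. *)
by rewrite leq_subRL //= addKb.
Qed.

Lemma odd_bin_mod2X (n j i : nat) :
  (i < 2 ^ n)%N -> odd 'C(j %% 2 ^ n, i) = odd 'C(j, i).
Proof.
move=> lt_i; rewrite {2}(divn_eq j (2 ^ n)) addnC.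
elim: (j %/ 2 ^ n)%N => [|q IHq]; first by rewrite addn0.
by rewrite mulSn addnCA addnC odd_bin_add2X leqNgt lt_i addbF.
Qed.

Lemma F2_nat_odd (m : nat) : m%:R = (odd m)%:R :> 'F_2.
Proof. by rewrite -{1}[m]odd_double_half natrD -mul2n natrM pchar_Fp_0 // mul0r addr0. Qed.

(** Evaluated at the representative of [x] below 2^n; for i < 2^n any other representative gives the
    same value, by [odd_bin_mod2X]. *)
Definition binF2 (n i : nat) (x : 'Z_(2 ^ n)) : 'F_2 := 'C(x, i)%:R.
Arguments binF2 {n} i x.

Section Spins.
Variable m : nat.
Local Notation Z := 'Z_(2 ^ m.+1).

Lemma expn2S_gt1 : (1 < 2 ^ m.+1)%N.
Proof. by rewrite -{1}(expn0 2) ltn_exp2l. Qed.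
Local Hint Resolve expn2S_gt1 : core.

Lemma ltn_Zp2 (x : Z) : (x < 2 ^ m.+1)%N.
Proof. by rewrite -[X in (_ < X)%N](Zp_cast expn2S_gt1). Qed.

Lemma binF2_nat (i k : nat) :
  (i < 2 ^ m.+1)%N -> binF2 i (k%:R : Z) = 'C(k, i)%:R.
Proof.
by move=> lt_i; rewrite /binF2 val_Zp_nat // F2_nat_odd odd_bin_mod2X // -F2_nat_odd.
Qed.

Lemma binF20 (x : Z) : binF2 0 x = 1.
Proof. by rewrite /binF2 bin0. Qed.

(** Periodicity makes Pascal's rule survive the wrap-around at x = -1. *)
Lemma binF2S (i : nat) (x : Z) : (i.+1 < 2 ^ m.+1)%N ->
  binF2 i.+1 (x + 1) = binF2 i.+1 x + binF2 i x.
Proof.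
move=> lt_i; rewrite -[x]natr_Zp natr1 !binF2_nat //; last exact: ltnW.
by rewrite binS natrD.
Qed.

Lemma eq_Zp2_nat (x : Z) (k : nat) :
  (k < 2 ^ m.+1)%N -> (x == k%:R) = (x == k :> nat).
Proof. by move=> lt_k; rewrite -val_eqE /= val_Zp_nat // modn_small. Qed.

Lemma N1_Zp2 : -1 = ((2 ^ m.+1).-1)%:R :> Z.
Proof. by apply/eqP; rewrite eq_sym -addr_eq0 natr1 prednK ?expn_gt0 ?pchar_Zp. Qed.

Lemma binF2_last (x : Z) : binF2 (2 ^ m.+1).-1 x = (x == -1)%:R.
Proof.
have lt_x := ltn_Zp2 x; rewrite N1_Zp2 eq_Zp2_nat /binF2; last by lia.
have [-> | ne_x] := eqVneq; first by rewrite binn.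
by rewrite bin_small //; lia.
Qed.

Lemma binF2_half (x : Z) : binF2 (2 ^ m) x = (2 ^ m <= x)%N%:R.
Proof.
rewrite /binF2 F2_nat_odd; have [lt_x | le_x] := ltnP; first by rewrite bin_small.
rewrite -(subnK le_x) odd_bin_add2X leqnn subnn bin0 bin_small //.
by have := ltn_Zp2 x; have := expnS 2 m; lia.
Qed.

Lemma half_Zp2_double : ((2 ^ m)%:R : Z) + (2 ^ m)%:R = 0.
Proof. by rewrite -natrD addnn -mul2n -expnS pchar_Zp. Qed.

(** As a function of x, C(x, 2^m - 1) mod 2 has period 2^m, and below 2^m it is nonzero only at 2^m
    - 1. *)
Lemma binF2_prehalf (x : Z) :
  binF2 (2 ^ m).-1 x = ((x == -1) || (x == (2 ^ m)%:R - 1))%:R.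
Proof.
have lt_x := ltn_Zp2 x; have h_gt0 : (0 < 2 ^ m)%N by rewrite expn_gt0.
have -> : (2 ^ m)%:R - 1 = ((2 ^ m).-1)%:R :> Z.
  by rewrite -[in LHS](prednK h_gt0) -natr1 addrK.
have eqN := expnS 2 m; rewrite N1_Zp2 !eq_Zp2_nat; try lia.
rewrite /binF2 F2_nat_odd; congr (nat_of_bool _)%:R.
have [lt_xh | le_hx] := ltnP x (2 ^ m).
  have [-> | ne_x] := eqVneq (x : nat) (2 ^ m).-1; first by rewrite binn orbT.
  by rewrite bin_small ?orbF; lia.
rewrite -(subnK le_hx) odd_bin_add2X leqNgt prednK // leqnn addbF.
have [eq_x | ne_x] := eqVneq (x - 2 ^ m)%N (2 ^ m).-1.
  by rewrite eq_x binn; lia.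
by rewrite bin_small; lia.
Qed.

(** * Permitted configurations in coordinates *)

Definition vtx (x y z : Z) : vertex m.+1 := \row_i [:: x; y; z]`_i.

Lemma vtxE (v : vertex m.+1) : vtx (v 0 0) (v 0 1) (v 0 2) = v.
Proof.
apply/rowP => i; rewrite mxE; case: i => [[|[|[|i]]] lt_i] //=;
  by congr (v _ _); apply: val_inj.
Qed.

Lemma vtxD0 (x y z : Z) : vtx x y z + delta_mx 0 0 = vtx (x + 1) y z.
Proof. by apply/rowP => i; rewrite !mxE; case: i => [[|[|[|i]]] lt_i] //=; rewrite addr0. Qed.

Lemma vtxD1 (x y z : Z) : vtx x y z + delta_mx 0 1 = vtx x (y + 1) z.
Proof. by apply/rowP => i; rewrite !mxE; case: i => [[|[|[|i]]] lt_i] //=; rewrite addr0. Qed.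

Lemma vtxD2 (x y z : Z) : vtx x y z + delta_mx 0 2 = vtx x y (z + 1).
Proof. by apply/rowP => i; rewrite !mxE; case: i => [[|[|[|i]]] lt_i] //=; rewrite addr0. Qed.

Lemma permittedP (s : config m.+1) :
  reflect (forall x y z : Z,
     [/\ s 0 (vtx (x + 1) y z) = s 2 (vtx x y z),
         s 1 (vtx x (y + 1) z) = s 0 (vtx x y z)
       & s 2 (vtx x y (z + 1))
           = s 0 (vtx x y z) + s 1 (vtx x y z) + s 2 (vtx x y z)])
    (s \in permitted m.+1 matA).
Proof.
have I3 (f : 'I_3 -> 'F_2) : \sum_i f i = f 0 + f 1 + f 2.
  rewrite !big_ord_recl big_ord0 addr0 addrA; congr (f _ + f _ + f _); exact: val_inj.
have rowE (v : vertex m.+1) j : ((\row_i s i v) *m matA) 0 j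
   = s 0 v * matA 0 j + s 1 v * matA 1 j + s 2 v * matA 2 j.
  by rewrite mxE I3 !mxE.
rewrite inE; apply: (iffP forallP) => [sP x y z | sP v].
  have {}sP j := congr1 (fun r : 'rV__ => r 0 j) (eqP (sP (vtx x y z))).
  have [] := (sP 0, sP 1, sP 2); case.
  rewrite !rowE !mxE /= vtxD0 vtxD1 vtxD2 => -> -> ->.
  by rewrite !mulr0 !mulr1 !add0r !addr0.
apply/eqP/rowP => j; rewrite rowE -[v]vtxE.
have [sP0 sP1 sP2] := sP (v 0 0) (v 0 1) (v 0 2).
have [-> | [-> | ->]] : j = 0 \/ (j = 1 \/ j = 2).
  by case: j => [[|[|[|j]]] lt_j] //; [left | right; left | right; right]; apply: val_inj.
- by rewrite !mxE /= vtxD0 sP0 !mulr0 mulr1 !add0r.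
- by rewrite !mxE /= vtxD1 sP1 !mulr0 mulr1 !addr0.
- by rewrite !mxE /= vtxD2 sP2 !mulr1.
Qed.

Lemma permitted_add (s u : config m.+1) : u \in permitted m.+1 matA ->
  (s + u \in permitted m.+1 matA) = (s \in permitted m.+1 matA).
Proof.
have addP (a b : config m.+1) : a \in permitted m.+1 matA ->
    b \in permitted m.+1 matA -> a + b \in permitted m.+1 matA.
  move=> /permittedP aP /permittedP bP; apply/permittedP => x y z.
  have [a0 a1 a2] := aP x y z; have [b0 b1 b2] := bP x y z.
  rewrite !ffunE a0 a1 a2 b0 b1 b2; split=> //; ring.
have uu : u + u = 0.
  apply/ffunP => i; apply/ffunP => v; rewrite !ffunE.
  ring: F2_2.
move=> uP; apply/idP/idP => [suP | sP]; last exact: addP.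
by rewrite -[s]addr0 -uu addrA addP.
Qed.

Lemma spin_recurrence (s : config m.+1) (x y z : Z) :
  s \in permitted m.+1 matA ->
  s 0 (vtx x (y - 1) z) =
    s 0 (vtx x y z) + s 0 (vtx (x + 1) y z) + s 0 (vtx (x + 1) y (z + 1)).
Proof.
move=> /permittedP sP; have [s02 _ s2] := sP x y z.
have [_ s10 _] := sP x (y - 1) z; rewrite subrK in s10.
have [s02' _ _] := sP x y (z + 1); rewrite s02' s02 s2 s10.
ring: F2_2.
Qed.

(** The first two columns of [matA] dictate the other spins: [s 1] is [g] shifted back along y, and
    [s 2] is [g] shifted forward along x. The third column is then the recurrence. *)
Lemma permitted_extension (g : Z -> Z -> Z -> 'F_2) :
    (forall x y z, g x (y - 1) z = g x y z + g (x + 1) y z + g (x + 1) y (z + 1)) ->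
  exists2 s, s \in permitted m.+1 matA & forall x y z, s 0 (vtx x y z) = g x y z.
Proof.
move=> gP.
pose s : config m.+1 := [ffun i : 'I_3 => [ffun v : vertex m.+1 =>
  [:: g (v 0 0) (v 0 1) (v 0 2); g (v 0 0) (v 0 1 - 1) (v 0 2);
      g (v 0 0 + 1) (v 0 1) (v 0 2)]`_i]].
exists s; last by move=> x y z; rewrite !ffunE /= !mxE.
apply/permittedP => x y z; rewrite !ffunE /= !mxE /= addrK; split=> //; rewrite gP.
ring: F2_2.
Qed.

(* Over F_2 the operator 1 + T_1 + T_1 T_3 commutes with its summands, so its
   2^k-th power is obtained by raising each summand to the power 2^k. *)
Lemma spin_recurrence2X (s : config m.+1) (k : nat) (x y z : Z) :
  s \in permitted m.+1 matA ->
  s 0 (vtx x (y - (2 ^ k)%:R) z) =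
    s 0 (vtx x y z) + s 0 (vtx (x + (2 ^ k)%:R) y z)
      + s 0 (vtx (x + (2 ^ k)%:R) y (z + (2 ^ k)%:R)).
Proof.
move=> sP; elim: k x y z => [|k IHk] x y z; first exact: spin_recurrence.
have -> : (2 ^ k.+1)%:R = (2 ^ k)%:R + (2 ^ k)%:R :> Z.
  by rewrite -natrD addnn -mul2n -expnS.
rewrite opprD !addrA !IHk.
ring: F2_2.
Qed.

Lemma sum_square_spins (s : config m.+1) (c y z : Z) :
    s \in permitted m.+1 matA -> let h := (2 ^ m)%:R in
  s 0 (vtx c y z) + s 0 (vtx c (y + h) z) + s 0 (vtx c y (z + h))
    + s 0 (vtx c (y + h) (z + h)) = 0.
Proof.
move=> sP h; have hh : h + h = 0 := half_Zp2_double.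
(* Since h = -h, the recurrence for step h applies to the spins at y + h. *)
have -> : y + h = y - h by apply/eqP; rewrite -subr_eq0 opprD opprK addrACA subrr add0r hh.
rewrite !spin_recurrence2X // -/h -[z + h + h]addrA hh addr0.
ring: F2_2.
Qed.

(** * Binomial configurations and the sets they detect *)

(* The planes [i] and [i + 1] match by Pascal's rule; from [i = N - 1] back to
   [i = 0] the factor [C(-, 0) = 1] makes both differences vanish. *)
Lemma binF2_spins (c b e : Z) (i : nat) : (i < 2 ^ m.+1)%N ->
  exists2 s, s \in permitted m.+1 matA & forall y z : Z,
    s 0 (vtx c y z) = binF2 ((2 ^ m.+1).-1 - i) (b - y) * binF2 i (z + e).
Proof.
move=> lt_i.
(* The offset gives the plane x = c the index t = i. *)
pose g (x y z : Z) : 'F_2 := let t := x - c + i%:R in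
  binF2 ((2 ^ m.+1).-1 - t) (b - y) * binF2 t (z + e).
have [x y z|s sP sE] := permitted_extension g; last first.
  exists s => // y z.
  by rewrite sE /g subrr add0r val_Zp_nat // modn_small.
rewrite /g [x + 1 - c]addrAC [x - c + 1 + _]addrAC; move: (x - c + i%:R) => t.
have -> : b - (y - 1) = b - y + 1 by rewrite opprB addrA addrAC.
have lt_t := ltn_Zp2 t.
have [eq_t | ne_t] := eqVneq (t : nat) (2 ^ m.+1).-1.
  have -> : t + 1 = 0 by apply/eqP; rewrite addr_eq0 N1_Zp2 eq_Zp2_nat ?eq_t //; lia.
  by rewrite eq_t subnn subn0 !binF20; ring: F2_2.
have lt_t1 : (t.+1 < 2 ^ m.+1)%N by lia.
have -> : nat_of_ord (t + 1)%R = t.+1.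
  by apply/eqP; rewrite -eq_Zp2_nat // -natr1 natr_Zp.
have -> : ((2 ^ m.+1).-1 - t = ((2 ^ m.+1).-1 - t.+1).+1)%N by lia.
rewrite binF2S; last by lia.
rewrite [z + 1 + e]addrAC binF2S //.
ring: F2_2.
Qed.

(** Two representatives below 2^m have a sum below 2^(m+1); for x and -x that sum is 0 in [Z], so it
    would be 0 and x = 0. *)
Lemma half_Zp2_opp (x : Z) : x != 0 -> (2 ^ m <= x)%N || (2 ^ m <= nat_of_ord (- x)%R)%N.
Proof.
apply: contraNT; rewrite negb_or -!ltnNge => /andP[lt_x lt_Nx].
have lt_xNx : (x + nat_of_ord (- x)%R < 2 ^ m.+1)%N by have := expnS 2 m; lia.
have := eq_Zp2_nat 0 _ lt_xNx; rewrite natrD !natr_Zp subrr eqxx.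
by rewrite eq_sym addn_eq0 => /esym/andP[/eqP x0 _]; apply/eqP/val_inj.
Qed.

Lemma vanishing_sum_square (c : Z) (K : {set point m.+1}) :
    K != set0 -> (#|K| <= 4)%N ->
    (forall s, s \in permitted m.+1 matA -> \sum_(p in K) plane_spin c p s = 0) ->
  exists y z : Z, K = square y z.
Proof.
move=> K_n0 leK4 K0; have eqN := expnS 2 m; have h_gt0 := expn_gt0 2 m.
have test b e i : (i < 2 ^ m.+1)%N ->
    \sum_(p in K) binF2 ((2 ^ m.+1).-1 - i) (b - p.1) * binF2 i (p.2 + e) = 0.
  move=> lt_i; have [s sP sE] := binF2_spins c b e i lt_i.
  by rewrite -[RHS](K0 s sP); apply: eq_bigr => p _; rewrite -sE.
have colK b : \sum_(p in K) (p.1 == b)%:R = 0 :> 'F_2.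
  rewrite -[RHS](test (b - 1) 0 0); last by lia.
  apply: eq_bigr => p _; rewrite subn0 binF2_last binF20 mulr1; congr (nat_of_bool _)%:R.
  by rewrite addrAC -[in RHS]subr_eq0 opprK subrK subr_eq0 eq_sym.
have rowK e : \sum_(p in K) (p.2 == e)%:R = 0 :> 'F_2.
  rewrite -[RHS](test 0 (- 1 - e) (2 ^ m.+1).-1); last by lia.
  apply: eq_bigr => p _; rewrite subnn binF2_last binF20 mul1r; congr (nat_of_bool _)%:R.
  by rewrite addrA -[in RHS]subr_eq0 opprK addrAC subrK subr_eq0.
have [k [k' [j [j' [ne_k ne_j r_uniq eqK]]]]] := F2_rectangle_even K_n0 leK4 colK rowK.
have sumK (F G : Z -> 'F_2) :
    \sum_(p in K) F p.1 * G p.2 = (F k + F k') * (G j + G j').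
  by rewrite (eq_bigl _ _ eqK) -big_uniq //= !big_cons big_nil /=; ring.
have k'E : k' = k + (2 ^ m)%:R.
  (* With b = k - 1 the first factor is 1 unless k' is k or k + 2^m. If it is 1, then j + e and j' +
     e lie in the same half for every e, which e = -j and e = -j' refute. *)
  have testB e : (binF2 (2 ^ m).-1 (k - 1 - k) + binF2 (2 ^ m).-1 (k - 1 - k'))
      * (binF2 (2 ^ m) (j + e) + binF2 (2 ^ m) (j' + e)) = 0.
    rewrite -(sumK (fun x => binF2 _ (k - 1 - x)) (fun x => binF2 _ (x + e))).
    rewrite -[RHS](test (k - 1) e (2 ^ m)%N); last by lia.
    by have -> : ((2 ^ m.+1).-1 - 2 ^ m = (2 ^ m).-1)%N by lia.
  apply/eqP; apply: contraT => ne_k'.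
  have eq_half e : (2 ^ m <= nat_of_ord (j + e)%R)%N = (2 ^ m <= nat_of_ord (j' + e)%R)%N.
    have := testB e; rewrite !binF2_prehalf !binF2_half.
    have -> : k - 1 - k == -1 by rewrite addrAC subrr add0r.
    have /negPf -> : k - 1 - k' != -1.
      by rewrite addrAC -[X in _ == X]add0r (inj_eq (addIr _)) subr_eq0 eq_sym.
    have /negPf -> : k - 1 - k' != (2 ^ m)%:R - 1.
      rewrite addrAC (inj_eq (addIr _)) subr_eq addrC.
      by apply: contra ne_k' => /eqP->; rewrite -addrA half_Zp2_double addr0.
    by rewrite /= addr0 mul1r; do 2!case: (_ <= _)%N.
  have := half_Zp2_opp (j' - j); rewrite subr_eq0 opprB => /(_ ne_j).
  by rewrite -eq_half subrr eq_half subrr orbb leqNgt h_gt0.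
have j'E : j' = j + (2 ^ m)%:R.
  (* The same argument with the axes exchanged: e = -1 - j puts j at -1. *)
  have testC b : (binF2 (2 ^ m) (b - k) + binF2 (2 ^ m) (b - k'))
      * (binF2 (2 ^ m).-1 (j + (- 1 - j)) + binF2 (2 ^ m).-1 (j' + (- 1 - j))) = 0.
    rewrite -(sumK (fun x => binF2 _ (b - x)) (fun x => binF2 _ (x + (- 1 - j)))).
    rewrite -[RHS](test b (- 1 - j) (2 ^ m).-1); last by lia.
    by have -> : ((2 ^ m.+1).-1 - (2 ^ m).-1 = 2 ^ m)%N by lia.
  apply/eqP; apply: contraT => ne_j'.
  have eq_half b : (2 ^ m <= nat_of_ord (b - k)%R)%N = (2 ^ m <= nat_of_ord (b - k')%R)%N.
    have := testC b; rewrite !binF2_prehalf !binF2_half.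
    have -> : j + (- 1 - j) == -1 by rewrite addrCA subrr addr0.
    have /negPf -> : j' + (- 1 - j) != -1.
      by rewrite addrCA -[X in _ == X]addr0 (inj_eq (addrI _)) subr_eq0.
    have /negPf -> : j' + (- 1 - j) != (2 ^ m)%:R - 1.
      by rewrite addrCA addrC (inj_eq (addIr _)) subr_eq addrC.
    by rewrite /= addr0 mulr1; do 2!case: (_ <= _)%N.
  have := half_Zp2_opp (k' - k); rewrite subr_eq0 opprB => /(_ ne_k).
  by rewrite eq_half subrr -eq_half subrr orbb leqNgt h_gt0.
exists k, j; apply/setP => p.
by rewrite eqK k'E j'E /square /= !inE -!orbA.
Qed.
End Spins.

(** * Squares and the probabilities *)

Definition square_seq (m : nat) (y z : 'Z_(2 ^ m.+1)) : seq (point m.+1) :=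
  let h := (2 ^ m)%:R in [:: (y, z); (y + h, z); (y, z + h); (y + h, z + h)].

Lemma mem_square (m : nat) (y z : 'Z_(2 ^ m.+1)) : square y z =i square_seq m y z.
Proof. by move=> p; rewrite /square /= !inE -!orbA. Qed.

Lemma square_seq_uniq (m : nat) (y z : 'Z_(2 ^ m.+1)) : uniq (square_seq m y z).
Proof.
rewrite /square_seq; set h := (2 ^ m)%:R.
have h_n0 : h != 0.
  by rewrite -val_eqE /= val_Zp_nat ?expn2S_gt1 // modn_small ?ltn_exp2l // -lt0n expn_gt0.
have neD (x : 'Z_(2 ^ m.+1)) : (x == x + h) = false.
  by rewrite eq_sym -subr_eq0 addrAC subrr add0r (negPf h_n0).
by rewrite /= !inE !xpair_eqE !neD ![_ + h == _]eq_sym !neD !andbF.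
Qed.

Lemma card_square (m : nat) (y z : 'Z_(2 ^ m.+1)) : #|square y z| = 4%N.
Proof. by rewrite (eq_card (mem_square m y z)) (card_uniqP (square_seq_uniq m y z)). Qed.

Lemma sum_plane_spin_square (m : nat) (s : config m.+1) (c y z : 'Z_(2 ^ m.+1)) :
  s \in permitted m.+1 matA -> \sum_(p in square y z) plane_spin c p s = 0.
Proof.
move=> sP; rewrite (eq_bigl _ _ (mem_square m y z)) -big_uniq ?square_seq_uniq //=.
by rewrite !big_cons big_nil addr0 !addrA; exact: sum_square_spins.
Qed.

(** A nonempty [K] inside [J] with identically vanishing sum would be a square; otherwise some
    permitted [u] has sum 1 over [K], and translation by [u] is the map that [prob_free] asks
    for. *)
Lemma plane_spin_prob (m : nat) (c : 'Z_(2 ^ m.+1)) (J : {set point m.+1})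
    (B : point m.+1 -> {set 'F_2}) :
    (#|J| <= 4)%N -> (forall y z : 'Z_(2 ^ m.+1), ~~ (square y z \subset J)) ->
  prob (permitted m.+1 matA)
      [set s : config m.+1 | [forall p in J, plane_spin c p s \in B p]]
    = \prod_(p in J) (#|B p|%:R / 2).
Proof.
move=> leJ4 noSq; apply: prob_free => [|K sKJ K_n0]; first exact: permitted_neq0.
have [/exists_inP[u uP sum_u] | /exists_inPn noU] := boolP
    [exists u in permitted m.+1 matA, \sum_(p in K) plane_spin c p u != 0].
  exists (+%R^~ u); split=> [|s|s]; [exact: addIr | exact: permitted_add |].
  have <- : \sum_(p in K) plane_spin c p u = 1.
    by case: (F2_cases (\sum_(p in K) plane_spin c p u)) sum_u => ->; rewrite ?eqxx.
  by rewrite -big_split; apply: eq_bigr => p _; rewrite /plane_spin !ffunE.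
have leK4 : (#|K| <= 4)%N by apply: leq_trans leJ4; exact: subset_leq_card.
have [s sP|y [z eqK]] := vanishing_sum_square m c K K_n0 leK4.
  by apply/eqP; have := noU s sP; rewrite negbK.
by have := noSq y z; rewrite -eqK sKJ.
Qed.

Lemma plane_spin_prob0 (m : nat) (c : 'Z_(2 ^ m.+1)) (J : {set point m.+1}) :
    (#|J| <= 4)%N -> (forall y z : 'Z_(2 ^ m.+1), ~~ (square y z \subset J)) ->
  prob (permitted m.+1 matA)
      [set s : config m.+1 | [forall p in J, plane_spin c p s == 0]]
    = 2^-1 ^+ #|J|.
Proof.
move=> leJ4 noSq; rewrite -prodr_const.
have := plane_spin_prob m c J (fun=> [set 0]) leJ4 noSq.
rewrite cards1 mul1r => <-; congr prob; apply/setP => s; rewrite !inE.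
by apply: eq_forallb => p; rewrite inE.
Qed.

Theorem theorem7 (n : nat) (hn : (1 <= n)%N) (c : 'Z_(2 ^ n))
    (P : {set point n}) (hP : #|P| = 4%N) :
  ((exists y z : 'Z_(2 ^ n), P = square y z) ->
     prob (permitted n matA)
       [set s : config n | [forall p in P, plane_spin c p s == 0]] = 1 / 8) /\
  (~ (exists y z : 'Z_(2 ^ n), P = square y z) ->
     prob (permitted n matA)
       [set s : config n | [forall p in P, plane_spin c p s == 0]] = 1 / 16 /\
     independent (permitted n matA) (plane_spin c) P).
Proof.
case: n hn c P hP => // m _ c P hP; split=> [[y [z P_sq]] | nsqP].
  (* The spins of a square sum to 0, so the one at [p0] is 0 once the other three are; three points
     contain no square. *)
  pose p0 : point m.+1 := (y, z).
  have p0P : p0 \in P by rewrite P_sq /square !inE eqxx.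
  have cardJ : #|P :\ p0| = 3%N by have := cardsD1 p0 P; rewrite p0P hP => -[].
  have -> : 1 / 8 = 2^-1 ^+ #|P :\ p0| :> rat by rewrite cardJ.
  rewrite -(plane_spin_prob0 m c) ?cardJ // => [|y' z']; last first.
    by apply/negP => /subset_leq_card; rewrite card_square cardJ.
  rewrite /prob; congr (_%:R / _); apply: eq_card => s; rewrite !in_setI.
  case sP: (s \in permitted m.+1 matA) => //=; rewrite !inE.
  apply/forall_inP/forall_inP => s0 p; first by rewrite !inE => /andP[_]; exact: s0.
  have [-> _ | ne_p pP] := eqVneq p p0; last by apply: s0; rewrite !inE ne_p.
  rewrite -(sum_plane_spin_square m s c y z sP) -P_sq (bigD1 p0) //= big1 ?addr0 //.
  by move=> q /andP[qP ne_q]; apply/eqP/s0; rewrite !inE ne_q.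
have noSq (J : {set point m.+1}) : J \subset P ->
    forall y z : 'Z_(2 ^ m.+1), ~~ (square y z \subset J).
  move=> sJP y z; apply/negP => sqJ; apply: nsqP; exists y, z; apply/esym/eqP.
  by rewrite eqEcard (subset_trans sqJ) // card_square hP.
have le4 (J : {set point m.+1}) : J \subset P -> (#|J| <= 4)%N.
  by move=> /subset_leq_card; rewrite hP.
split=> [|J B sJP].
  by rewrite plane_spin_prob0 ?hP //; exact: noSq.
rewrite plane_spin_prob; [| exact: le4 | exact: noSq].
(* Each marginal is the same formula for the singleton of [p]. *)
apply: eq_bigr => p pJ; have s1P : [set p] \subset P by rewrite sub1set (subsetP sJP).
have := plane_spin_prob m c [set p] B (le4 _ s1P) (noSq _ s1P).
rewrite big_set1 => <-; congr prob; apply/setP => s; rewrite !inE.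
by apply/forall_inP/idP => [/(_ p)|sB q]; rewrite inE; [apply | move/eqP->].
Qed.
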